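(* Let $f_i \colon M_i \to M_{i+1}$ for $i \in \{1,2\}$ be continuous maps between manifolds. If the pair $(f_1,f_2)$ is Whitney-regular, then $$C_{f_2 \circ f_1} \subseteq C_{f_1} \circ C_{f_2}.$$ The reverse inclusion holds if $f_2$ is $C^1$ (without assuming the pair Whitney-regular).
   Context: Manifolds are real, finite-dimensional, smooth ($C^\infty$), paracompact and Hausdorff. Whitney cone: for subsets $A,B$ of a manifold $P$ and $p\in P$, $C_p(A,B)$ is the set of $u \in T_pP$ for which there are sequences $x_n \in A$, $y_n \in B$, $c_n \in \mathbb{R}_{>0}$ with $x_n \to p$, $y_n \to p$ and $c_n(y_n - x_n) \to u$ (computed in a chart at $p$; independent of the chart); $C(A,B) = \bigcup_p C_p(A,B) \subseteq TP$. For a continuous map $f \colon M \to N$ with graph $\Gamma_f$, $C_f = C(\Gamma_f,\Gamma_f) \subseteq T(M\times N) \cong TM \times TN$. Composition is composition of relations: $C_{f_1} \circ C_{f_2} = \{(u_1,u_3) \in TM_1 \times TM_3 \mid \exists u_2 \in TM_2,\ (u_1,u_2) \in C_{f_1},\ (u_2,u_3) \in C_{f_2}\}$ (elements of the tangent bundles include their base points). The pair $(f_1,f_2)$ is Whitney-regular if $(C_{f_1} \times 0_3) \cap (0_1 \times C_{f_2}) \subseteq 0_{123}$, where $0_i$ is the zero section of $TM_i$ and $0_{123}$ that of $T(M_1\times M_2\times M_3)$; i.e. whenever $u_2 \in TM_2$ satisfies $(0_{x_1},u_2) \in C_{f_1}$ and $(u_2,0_{x_3}) \in C_{f_2}$ for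 some $x_1 \in M_1$, $x_3\in M_3$, then $u_2$ is a zero vector. *)

(* Defs.v *)
From HB Require Import structures.
From mathcomp Require Import all_boot all_order all_algebra.
From mathcomp Require Import boolp classical_sets functions cardinality reals.
From mathcomp Require Import topology normedtype landau derive.

Set Implicit Arguments.
Unset Strict Implicit.
Unset Printing Implicit Defensive.

Import Order.TTheory GRing.Theory Num.Theory.
Import numFieldNormedType.Exports.

Local Open Scope classical_set_scope.
Local Open Scope ring_scope.

(* [Ck k U f] is meant for open [U]: only the germs of [f] at points of [U]
   matter, and for [f] differentiable ['D_v f x] is ['d f x v]. *)
Fixpoint Ck (R : realType) (m n k : nat) (U : set 'rV[R]_m)
    (f : 'rV[R]_m -> 'rV[R]_n) : Prop :=
  if k is k'.+1 then
    (forall x, U x -> differentiable f x) /\ (forall v, Ck k' U ('D_v f))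
  else forall x, U x -> {for x, continuous f}.

Definition smooth_on (R : realType) (m n : nat) (U : set 'rV[R]_m)
    (f : 'rV[R]_m -> 'rV[R]_n) : Prop :=
  forall k, Ck k U f.

Definition locally_finite (T : topologicalType) (V : set (set T)) : Prop :=
  forall x : T, exists2 N, nbhs x N & finite_set [set B | V B /\ B `&` N !=set0].

Definition open_cover (T : topologicalType) (U : set (set T)) : Prop :=
  (forall A, U A -> open A) /\ \bigcup_(A in U) A = [set: T].

Definition paracompact (T : topologicalType) : Prop :=
  forall U : set (set T), open_cover U ->
  exists V : set (set T), [/\ open_cover V,
    forall B, V B -> exists2 A, U A & B `<=` A & locally_finite V].

(* A topological space with a smooth atlas.  [coord i] and [param i] are total
   functions, meaningful on [dom i] and on [coord i @` dom i] respectively,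
   where they are mutually inverse homeomorphisms.  The dimension may depend on
   the chart, so that connected components may have different dimensions; empty
   and zero-dimensional spaces are included. *)
Record smoothSpace (R : realType) := SmoothSpace {
  carrier :> topologicalType;
  chart : Type;
  dim : chart -> nat;
  dom : chart -> set carrier;
  coord : forall i, carrier -> 'rV[R]_(dim i);
  param : forall i, 'rV[R]_(dim i) -> carrier;
  dom_cover : forall p, exists i, dom i p;
  dom_open : forall i, open (dom i);
  image_open : forall i, open (coord i @` dom i);
  coordK : forall i p, dom i p -> param (coord i p) = p;
  coord_cont : forall i p, dom i p -> {for p, continuous (coord i)};
  param_cont : forall i p, dom i p ->
    {for coord i p, continuous (@param i)};
  transition_smooth : forall i j,
    smooth_on (coord i @` (dom i `&` dom j)) (coord j \o @param i)
}.
Arguments chart {R} s.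
Arguments dim {R s} i.
Arguments dom {R s} i.
Arguments coord {R s} i.
Arguments param {R s} i.

(* Whitney cones only involve the smooth atlas, so the product of two manifolds
   is only needed as a [smoothSpace]. *)
Record manifold (R : realType) := Manifold {
  manifold_space :> smoothSpace R;
  manifold_hausdorff : hausdorff_space manifold_space;
  manifold_paracompact : paracompact manifold_space
}.

Section tangent.
Variables (R : realType) (M : smoothSpace R).

Definition transition (i j : chart M) : 'rV[R]_(dim i) -> 'rV[R]_(dim j) :=
  coord j \o param i.
Arguments transition : clear implicits.

Definition chart_at (p : M) := {i : chart M | dom i p}.

(* A tangent vector at [p] is the family of its coordinate vectors in all the
   charts at [p], which transform by the differentials of the transitions. *)
Record tangent (p : M) := Tangent {
  tcoord : forall i : chart_at p, 'rV[R]_(dim (sval i));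
  tcoordE : forall i j : chart_at p,
    tcoord j = 'd (transition (sval i) (sval j)) (coord (sval i) p) (tcoord i)
}.

Definition TM := {p : M & tangent p}.

Definition zero_section : set TM :=
  [set u | forall i, tcoord (projT2 u) i = 0].

Definition whitney_cone_at (A B : set M) (p : M) : set (tangent p) :=
  [set u | exists (i : chart_at p) (x y : nat -> M) (c : nat -> R),
    [/\ forall n, [/\ A (x n), B (y n) & 0 < c n],
        x @ \oo --> p, y @ \oo --> p &
        (fun n => c n *: (coord (sval i) (y n) - coord (sval i) (x n))) @ \oo
          --> tcoord u i]].

Definition whitney_cone (A B : set M) : set TM :=
  [set u | whitney_cone_at A B (projT2 u)].

End tangent.
Arguments transition {R M} i j _.
Arguments TM {R} M.
Arguments zero_section {R} M.

Section Ck_theory.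
Variable R : realType.

Lemma near_eq_diff (V W : normedModType R) (f g : V -> W) (x : V) :
  (\near x, f x = g x) -> differentiable f x ->
  differentiable g x /\ 'd g x = 'd f x :> (V -> W).
Proof.
move=> fg df.
have [fc fE] := (diff_locallyP _ _).1 df.
have fgx : f x = g x by exact: nbhs_singleton fg.
have gE : g \o shift x = cst (g x) + 'd f x +o_ 0 id.
  apply/eqaddoP => e e0.
  have /eqaddoP/(_ e e0) fe := fE.
  have fg0 : \forall y \near (0 : V), f (y + x) = g (y + x).
    by move: fg; rewrite (near_shift 0) subr0.
  near=> y.
  have -> : (g \o shift x - (cst (g x) + 'd f x)) y =
            (f \o shift x - (cst (f x) + 'd f x)) y.
    by rewrite !fctE /= fgx; congr (_ - _); rewrite -(near fg0 y).
  by near: y.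
have dgE : 'd g x = 'd f x :> (V -> W) by exact: diff_unique.
split; last exact: dgE.
by apply/diff_locallyP; split; [rewrite dgE|rewrite gE dgE].
Unshelve. all: by end_near. Qed.

Lemma Ck_ext m n k (U : set 'rV[R]_m) (f g : 'rV[R]_m -> 'rV[R]_n) :
  open U -> (forall x, U x -> f x = g x) -> Ck k U f -> Ck k U g.
Proof.
move=> oU; elim: k f g => [|k IHk] f g fg.
  move=> fc x Ux; have := fc x Ux; rewrite /prop_for/= /continuous_at -fg//.
  have nfg : \forall y \near x, f y = g y.
    by have := open_nbhs_nbhs (conj oU Ux); apply: filterS => y /fg.
  exact: cvg_trans (near_eq_cvg nfg).
have nfg x : U x -> \near x, f x = g x.
  by move=> Ux; have := open_nbhs_nbhs (conj oU Ux); apply: filterS => y /fg.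
move=> [fd fD]; split.
  by move=> x Ux; case: (near_eq_diff (nfg _ Ux) (fd _ Ux)).
by move=> v; apply: IHk (fD v) => x Ux; exact/near_eq_derive/nfg.
Qed.

Lemma continuous_row_mx n1 n2 :
  continuous (fun p : 'rV[R]_n1 * 'rV[R]_n2 => row_mx p.1 p.2).
Proof.
move=> p A /nbhs_ballP[e /= e0 eA].
apply/nbhs_ballP; exists e => //= q [[_ pq1] [_ pq2]].
apply: eA; split => // i j; rewrite !mxE.
by case: (fintype.split j) => k; [exact: pq1|exact: pq2].
Qed.

Lemma continuous_pair (T U V : topologicalType) (f : T -> U) (g : T -> V) x :
  {for x, continuous f} -> {for x, continuous g} ->
  {for x, continuous (fun y => (f y, g y))}.
Proof. by move=> cf cg; exact: (cvg_pair cf cg). Qed.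

Definition prodmap m1 n1 m2 n2 (f : 'rV[R]_m1 -> 'rV[R]_n1)
    (g : 'rV[R]_m2 -> 'rV[R]_n2) : 'rV[R]_(m1 + m2) -> 'rV[R]_(n1 + n2) :=
  fun z => row_mx (f (lsubmx z)) (g (rsubmx z)).

Section prodmap.
Variables (m1 n1 m2 n2 : nat).
Implicit Types (f : 'rV[R]_m1 -> 'rV[R]_n1) (g : 'rV[R]_m2 -> 'rV[R]_n2).

Lemma cvg_prodmap f g z :
  {for lsubmx z, continuous f} -> {for rsubmx z, continuous g} ->
  {for z, continuous (prodmap f g)}.
Proof.
move=> cf cg.
apply: (@continuous_comp _ _ _ (fun z => (f (lsubmx z), g (rsubmx z)))
  (fun p => row_mx p.1 p.2)); last exact: continuous_row_mx.
apply: continuous_pair.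
  by apply: (@continuous_comp _ _ _ lsubmx f) cf; exact: continuous_lsubmx.
by apply: (@continuous_comp _ _ _ rsubmx g) cg; exact: continuous_rsubmx.
Qed.

Lemma diff_prodmap f g z :
  differentiable f (lsubmx z) -> differentiable g (rsubmx z) ->
  differentiable (prodmap f g) z /\
  'd (prodmap f g) z = prodmap ('d f (lsubmx z)) ('d g (rsubmx z)) :> (_ -> _).
Proof.
move=> df dg.
have dl : differentiable (f \o lsubmx) z.
  exact: (differentiable_comp (differentiable_lsubmx z) df).
have dr : differentiable (g \o rsubmx) z.
  exact: (differentiable_comp (differentiable_rsubmx z) dg).
have lin : linear (fun p : 'rV[R]_n1 * 'rV[R]_n2 => row_mx p.1 p.2).
  by move=> a u v; rewrite scale_row_mx add_row_mx.
pose hM := GRing.isLinear.Build _ _ _ _ _ lin.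
pose h : {linear _ -> _} :=
  HB.pack (fun p : 'rV[R]_n1 * 'rV[R]_n2 => row_mx p.1 p.2) hM.
have hc : continuous h by exact: continuous_row_mx.
have dp := differentiable_pair dl dr.
have dh x : differentiable h x.
  exact: (@linear_differentiable R ('rV[R]_n1 * 'rV[R]_n2)%type 'rV[R]_(n1 + n2) h x hc).
have -> : prodmap f g = h \o (fun z => (f (lsubmx z), g (rsubmx z))) by [].
split; first exact: (differentiable_comp dp (dh _)).
rewrite (diff_comp dp (dh _)) (@diff_lin R ('rV[R]_n1 * 'rV[R]_n2)%type 'rV[R]_(n1 + n2) h _ hc) (diff_pair dl dr).
rewrite (diff_comp (differentiable_lsubmx z) df).
rewrite (diff_comp (differentiable_rsubmx z) dg).
rewrite (diff_lin _ (@continuous_lsubmx _ _ _ _)).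
by rewrite (diff_lin _ (@continuous_rsubmx _ _ _ _)).
Qed.

End prodmap.

Lemma open_prod n1 n2 (U : set 'rV[R]_n1) (V : set 'rV[R]_n2) :
  open U -> open V -> open [set z | U (lsubmx z) /\ V (rsubmx z)].
Proof.
move=> oU oV; apply: openI; apply: open_comp => // z _.
  exact: continuous_lsubmx.
exact: continuous_rsubmx.
Qed.

Lemma Ck_prodmap m1 n1 m2 n2 k (U : set 'rV[R]_m1) (V : set 'rV[R]_m2)
    (f : 'rV[R]_m1 -> 'rV[R]_n1) (g : 'rV[R]_m2 -> 'rV[R]_n2) :
  open U -> open V -> Ck k U f -> Ck k V g ->
  Ck k [set z | U (lsubmx z) /\ V (rsubmx z)] (prodmap f g).
Proof.
move=> oU oV; elim: k f g => [|k IHk] f g.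
  by move=> fc gc z [/= Uz Vz]; apply: cvg_prodmap; [exact: fc|exact: gc].
move=> [fd fD] [gd gD]; split.
  by move=> z [/= Uz Vz]; have [] := diff_prodmap (fd _ Uz) (gd _ Vz).
move=> v; apply: Ck_ext (IHk _ _ (fD (lsubmx v)) (gD (rsubmx v))).
  exact: open_prod.
move=> z [/= Uz Vz]; have [d dE] := diff_prodmap (fd _ Uz) (gd _ Vz).
by rewrite deriveE// dE /prodmap !deriveE//; [exact: gd|exact: fd].
Qed.

End Ck_theory.

Section product.
Variable R : realType.

Lemma open_overlap (M : smoothSpace R) (i j : chart M) :
  open (coord i @` (dom i `&` dom j)).
Proof.
rewrite openE => _ [p [pi pj] <-].
have : nbhs (coord i p) (coord i @` dom i).
  by apply: open_nbhs_nbhs; split; [exact: image_open|exists p].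
have : nbhs (coord i p) (param i @^-1` dom j).
  apply: (param_cont pi); rewrite coordK//.
  by apply: open_nbhs_nbhs; split => //; exact: dom_open.
apply: filterS2 => z /= zj [q qi qz]; exists q => //; split => //.
by move: zj; rewrite -qz coordK.
Qed.

Variables M N : smoothSpace R.

Definition prod_chart : Type := (chart M * chart N)%type.
Definition prod_dim (k : prod_chart) : nat := (dim k.1 + dim k.2)%N.
Definition prod_dom (k : prod_chart) : set (M * N) := dom k.1 `*` dom k.2.
Definition prod_coord (k : prod_chart) (p : M * N) : 'rV[R]_(prod_dim k) :=
  row_mx (coord k.1 p.1) (coord k.2 p.2).
Definition prod_param (k : prod_chart) (z : 'rV[R]_(prod_dim k)) : M * N :=
  (param k.1 (lsubmx z), param k.2 (rsubmx z)).
Arguments prod_param : clear implicits.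

Lemma prod_imageE (k : prod_chart) (A : set M) (B : set N) :
  prod_coord k @` (A `*` B) =
  [set z | (coord k.1 @` A) (lsubmx z) /\ (coord k.2 @` B) (rsubmx z)].
Proof.
apply/seteqP; split => z /=.
  move=> [[p q] /= [Ap Bq] <-]; rewrite row_mxKl row_mxKr.
  by split; [exists p|exists q].
move=> [[p Ap pz] [q Bq qz]]; exists (p, q) => //.
by rewrite /prod_coord/= pz qz hsubmxK.
Qed.

Lemma prod_dom_cover p : exists k, prod_dom k p.
Proof.
by have [i ip] := dom_cover p.1; have [j jp] := dom_cover p.2; exists (i, j).
Qed.

Lemma prod_dom_open k : open (prod_dom k).
Proof.
rewrite openE => -[p q] [/= kp kq].
exists (dom k.1, dom k.2) => //=.
by split; apply: open_nbhs_nbhs; split => //; exact: dom_open.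
Qed.

Lemma prod_image_open k : open (prod_coord k @` prod_dom k).
Proof. by rewrite prod_imageE; apply: open_prod; exact: image_open. Qed.

Lemma prod_coordK k p : prod_dom k p -> prod_param k (prod_coord k p) = p.
Proof.
move=> [kp1 kp2]; rewrite /prod_param row_mxKl row_mxKr !coordK//.
by case: p kp1 kp2.
Qed.

Lemma prod_coord_cont k p : prod_dom k p -> {for p, continuous (prod_coord k)}.
Proof.
move=> [kp1 kp2].
apply: (@continuous_comp _ _ _ (fun p => (coord k.1 p.1, coord k.2 p.2))
  (fun p => row_mx p.1 p.2)); last exact: continuous_row_mx.
apply: continuous_pair.
  by apply: (@continuous_comp _ _ _ fst (coord k.1));
    [exact: cvg_fst|exact: coord_cont].
by apply: (@continuous_comp _ _ _ snd (coord k.2));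
  [exact: cvg_snd|exact: coord_cont].
Qed.

Lemma prod_param_cont k p : prod_dom k p ->
  {for prod_coord k p, continuous (prod_param k)}.
Proof.
move=> [kp1 kp2]; apply: continuous_pair.
  apply: (@continuous_comp _ _ _ lsubmx (param k.1));
    first exact: continuous_lsubmx.
  by rewrite row_mxKl; exact: param_cont.
apply: (@continuous_comp _ _ _ rsubmx (param k.2));
  first exact: continuous_rsubmx.
by rewrite row_mxKr; exact: param_cont.
Qed.

Lemma prod_transitionE k l :
  prod_coord l \o prod_param k =
  prodmap (transition k.1 l.1) (transition k.2 l.2).
Proof. by []. Qed.

Lemma prod_transition_smooth k l :
  smooth_on (prod_coord k @` (prod_dom k `&` prod_dom l))
    (prod_coord l \o prod_param k).
Proof.
move=> n; rewrite prod_transitionE /prod_dom -setXI prod_imageE.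
apply: Ck_prodmap; [exact: open_overlap|exact: open_overlap| |];
  exact: transition_smooth.
Qed.

Definition prod_space : smoothSpace R :=
  SmoothSpace prod_dom_cover prod_dom_open prod_image_open prod_coordK
    prod_coord_cont prod_param_cont prod_transition_smooth.

Definition chart_fst (p : M) (q : N)
    (k : chart_at (M := prod_space) (p, q)) : chart_at p :=
  exist _ (sval k).1 (let: conj h _ := proj2_sig k in h).

Definition chart_snd (p : M) (q : N)
    (k : chart_at (M := prod_space) (p, q)) : chart_at q :=
  exist _ (sval k).2 (let: conj _ h := proj2_sig k in h).

Lemma diff_prod_transition (p : M) (q : N)
    (k l : chart_at (M := prod_space) (p, q)) :
  'd (transition (M := prod_space) (sval k) (sval l))
     (coord (s := prod_space) (sval k) (p, q)) =
  prodmap ('d (transition (sval k).1 (sval l).1) (coord (sval k).1 p))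
          ('d (transition (sval k).2 (sval l).2) (coord (sval k).2 q))
  :> (_ -> _).
Proof.
case: k l => [[i j] [/= ip jq]] [[i' j'] [/= i'p j'q]].
have di : differentiable (transition i i') (lsubmx (row_mx (coord i p) (coord j q))).
  by rewrite row_mxKl; apply: (transition_smooth i i' 1).1; exists p.
have dj : differentiable (transition j j') (rsubmx (row_mx (coord i p) (coord j q))).
  by rewrite row_mxKr; apply: (transition_smooth j j' 1).1; exists q.
by have [_] := diff_prodmap di dj; rewrite row_mxKl row_mxKr.
Qed.

Lemma tangent_pairE (p : M) (q : N) (u : tangent p) (v : tangent q)
    (k l : chart_at (M := prod_space) (p, q)) :
  row_mx (tcoord u (chart_fst l)) (tcoord v (chart_snd l)) =
  'd (transition (M := prod_space) (sval k) (sval l))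
     (coord (s := prod_space) (sval k) (p, q))
     (row_mx (tcoord u (chart_fst k)) (tcoord v (chart_snd k))).
Proof.
rewrite (tcoordE u (chart_fst k)) (tcoordE v (chart_snd k)).
rewrite [RHS](congr1 (fun h => h _) (diff_prod_transition k l)).
by rewrite /prodmap row_mxKl row_mxKr.
Qed.

(* The canonical identification of TM x TN with T(M x N); see [TM_pair_bij]. *)
Definition tangent_pair (p : M) (q : N) (u : tangent p) (v : tangent q) :
    tangent (M := prod_space) (p, q) :=
  Tangent (tangent_pairE u v).

Definition TM_pair (uv : TM M * TM N) : TM prod_space :=
  existT _ (projT1 uv.1, projT1 uv.2)
    (tangent_pair (projT2 uv.1) (projT2 uv.2)).

End product.

Section TM_pair_bij.
Variable R : realType.

Lemma tangent_ext (M : smoothSpace R) (p : M) (u v : tangent p) :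
  (forall i, tcoord u i = tcoord v i) -> u = v.
Proof.
case: u v => [u uE] [v vE] /= uv.
have {}uv : u = v by exact: functional_extensionality_dep.
by case: _ / uv vE => vE; congr Tangent; exact: Prop_irrelevance.
Qed.

Variables M N : smoothSpace R.

Definition pair_chart (p : M) (q : N) (i : chart_at p) (j : chart_at q) :
    chart_at (M := prod_space M N) (p, q) :=
  exist _ (sval i, sval j) (conj (proj2_sig i) (proj2_sig j)).

Lemma tangent_pair_inj (p : M) (q : N) (u u' : tangent p) (v v' : tangent q) :
  tangent_pair u v = tangent_pair u' v' -> u = u' /\ v = v'.
Proof.
move=> uv; have [i ip] := dom_cover p; have [j jq] := dom_cover q.
have E (a : chart_at p) (b : chart_at q) :
    tcoord u a = tcoord u' a /\ tcoord v b = tcoord v' b.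
  have := congr1 (fun w => tcoord w (pair_chart a b)) uv.
  case: a b => [a ap] [b bq] /= h; have [E1 E2] := eq_row_mx h.
  by split; [exact: E1|exact: E2].
split; apply: tangent_ext => a.
  by have [] := E a (exist _ j jq).
by have [] := E (exist _ i ip) a.
Qed.

Lemma tangent_pair_surj (p : M) (q : N)
    (w : tangent (M := prod_space M N) (p, q)) :
  exists (u : tangent p) (v : tangent q), tangent_pair u v = w.
Proof.
have [i0 ip] := dom_cover p; have [j0 jq] := dom_cover q.
pose a0 : chart_at p := exist _ i0 ip; pose b0 : chart_at q := exist _ j0 jq.
have wE k l : tcoord w l = _ := etrans (tcoordE w k l)
  (congr1 (fun h => h _) (diff_prod_transition k l)).
pose uc (a : chart_at p) : 'rV[R]_(dim (sval a)) :=
  lsubmx (tcoord w (pair_chart a b0)).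
pose vc (b : chart_at q) : 'rV[R]_(dim (sval b)) :=
  rsubmx (tcoord w (pair_chart a0 b)).
have ucE a a' : uc a' = 'd (transition (sval a) (sval a')) (coord (sval a) p) (uc a).
  by rewrite /uc (wE (pair_chart a b0)) row_mxKl.
have vcE b b' : vc b' = 'd (transition (sval b) (sval b')) (coord (sval b) q) (vc b).
  by rewrite /vc (wE (pair_chart a0 b)) row_mxKr.
exists (Tangent ucE), (Tangent vcE); apply: tangent_ext => -[[i j] [ip' jq']] /=.
pose a : chart_at p := exist _ i ip'; pose b : chart_at q := exist _ j jq'.
rewrite -[RHS]/(tcoord w (pair_chart a b)).
rewrite -[LHS]/(row_mx (uc a) (vc b)) /uc /vc.
rewrite (wE (pair_chart a0 b0) (pair_chart a b0)).
rewrite (wE (pair_chart a0 b0) (pair_chart a0 b)).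
by rewrite (wE (pair_chart a0 b0) (pair_chart a b)) row_mxKl row_mxKr.
Qed.

Lemma TM_pair_bij : bijective (@TM_pair R M N).
Proof.
have surj (w : TM (prod_space M N)) : exists uv, TM_pair uv = w.
  case: w => [[p q] w]; have [u [v <-]] := tangent_pair_surj w.
  by exists (existT _ p u, existT _ q v).
have inj : injective (@TM_pair R M N).
  move=> [[p u] [q v]] [[p' u'] [q' v']] h.
  have [ep eq] := congr1 (@projT1 _ _) h.
  case: _ / ep u' h => u' h; case: _ / eq v' h => v' h.
  have := projT2_eq h; rewrite (Prop_irrelevance (projT1_eq h) erefl) /=.
  by move=> /tangent_pair_inj[-> ->].
have [g gK] := choice surj.
by exists g => // x; apply: inj; rewrite gK.
Qed.

End TM_pair_bij.

Definition graph (R : realType) (M N : manifold R) (f : M -> N) :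
    set (prod_space M N) :=
  [set z | z.2 = f z.1].

(* The cone [C_f], read in [TM x TN] instead of [T(M x N)]. *)
Definition map_cone (R : realType) (M N : manifold R) (f : M -> N) :
    set (TM M * TM N) :=
  [set uv | whitney_cone (graph f) (graph f) (TM_pair uv)].

(* Left-to-right composition, unlike the [\;] of [relation_scope]. *)
Definition rel_comp (T1 T2 T3 : Type) (A : set (T1 * T2)) (B : set (T2 * T3)) :
    set (T1 * T3) :=
  [set u | exists u2, A (u.1, u2) /\ B (u2, u.2)].

Definition whitney_regular (R : realType) (M1 M2 M3 : manifold R)
    (f1 : M1 -> M2) (f2 : M2 -> M3) : Prop :=
  forall (u1 : TM M1) (u2 : TM M2) (u3 : TM M3),
    map_cone f1 (u1, u2) /\ zero_section M3 u3 ->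
    zero_section M1 u1 /\ map_cone f2 (u2, u3) ->
    [/\ zero_section M1 u1, zero_section M2 u2 & zero_section M3 u3].

Definition C1_map (R : realType) (M N : manifold R) (f : M -> N) : Prop :=
  continuous f /\
  forall (i : chart M) (j : chart N),
    Ck 1 (coord i @` (dom i `&` f @^-1` dom j)) (coord j \o f \o param i).

(* Main.v *)
Require Import Defs.
From mathcomp Require Import all_boot all_order all_algebra.
From mathcomp Require Import boolp classical_sets functions cardinality reals.
From mathcomp Require Import topology normedtype landau derive.
From mathcomp Require Import sequences ring.

Set Implicit Arguments.
Unset Strict Implicit.
Unset Printing Implicit Defensive.

Import Order.TTheory GRing.Theory Num.Theory.
Import numFieldNormedType.Exports.
(* [coord] must denote chart coordinates, not those of vector spaces. *)
Import Defs.

Local Open Scope classical_set_scope.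
Local Open Scope ring_scope.

(** Both inclusions are read in charts. A pair [(u, v)] lies in [map_cone f]
    exactly when, in some charts, [u] and [v] are limits of difference quotients
    [c n * (y n - x n)] and [c n * (f (y n) - f (x n))] taken along the same
    sequences and with the same positive factors; the base point of [v] is then
    the image of that of [u], because [f] is continuous and its target Hausdorff
    ([map_coneP]).

    First inclusion. Given quotients representing [(u1, u3)] for the composite,
    let [d n] be the intermediate quotient, that of [f1]. If [d] is bounded, a
    subsequence of it converges to some [u2], which is the wanted intermediate
    vector. If not, then along a subsequence dividing everything by the norm of
    [d n] sends the first and third quotients to 0 and the second one to a unit
    vector [v]; then [(0, v)] and [(v, 0)] lie in the two cones, against
    Whitney-regularity. The two cases are treated at once by dividing by
    [max 1 |d n|] and making the inverse of this number converge too, to some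
    [t >= 0]: the first case is [t > 0], the second one is [t = 0]
    ([rescaled_subseq]).

    Second inclusion. A [C1] map is strictly differentiable: its difference
    quotients along two sequences with the same limit converge to the image of
    the direction by the differential ([Ck1_diff_quotient_cvg]). So the cone
    of [f2] lies in the graph of its tangent map, the vector [u3] is determined by
    [u2], and any quotients representing [(u1, u2)] also represent [(u1, u3)] for
    the composite. The charts used at the middle point for the two cones may
    differ, which is where the chain rule comes in ([diff_chart_change]). *)

(** * Convergent subsequences of row vectors *)

(** The extracted indices are only required to tend to infinity, which is all
    that passing to a subsequence in a limit needs. *)
Lemma cluster_subseq (R : realType) (V : normedModType R) (d : nat -> V)
    (v : V) :
  cluster (d @ \oo) v ->
  exists2 phi : nat -> nat, phi @ \oo --> \oo & d \o phi @ \oo --> v.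
Proof.
move=> dv.
have H n : exists m, (n <= m)%N /\ ball v n.+1%:R^-1 (d m).
  have dn : (d @ \oo) (d @` [set m | (n <= m)%N]).
    by exists n => // m /= nm; exists m.
  have vn : nbhs v (ball v n.+1%:R^-1).
    by apply: nbhsx_ballx; rewrite invr_gt0 ltr0n.
  have [_ [[m nm <-] bm]] := dv _ _ dn vn.
  by exists m.
have [phi phiP] := choice H.
exists phi.
  move=> A [N _ NA]; exists N => // n /= Nn; apply: NA => /=.
  exact: leq_trans Nn (phiP n).1.
apply/cvgrPdist_lt => e e0; near=> n => /=.
have := (phiP n).2; rewrite -ball_normE /= => /lt_trans; apply.
near: n; have /cvgrPdist_lt/(_ e e0) := @cvg_harmonic R.
apply: filterS => n; rewrite /harmonic /= sub0r normrN ger0_norm// invr_ge0.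
exact: ler0n.
Unshelve. all: by end_near. Qed.

Lemma bounded_rV_subseq (R : realType) (n : nat) (d : nat -> 'rV[R]_n) (C : R) :
  (forall k, `|d k| <= C) ->
  exists (v : 'rV[R]_n), exists2 phi : nat -> nat,
    phi @ \oo --> \oo & d \o phi @ \oo --> v.
Proof.
move=> dC; pose A : set 'rV[R]_n := Num.norm @^-1` [set x | x <= C].
have cA : compact A.
  apply: bounded_closed_compact.
    exists C; split; first exact: num_real.
    by move=> x Cx v /= Av; exact: le_trans Av (ltW Cx).
  by apply: closed_comp => [v _|]; [exact: (@norm_continuous _ _ v)|exact: closed_le].
have [v [_ /cluster_subseq[phi phioo dv]]] : A `&` cluster (d @ \oo) !=set0.
  by apply: (cA (d @ \oo)); exists 0%N => // k _; exact: dC.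
by exists v, phi.
Qed.

(** * Strict differentiability of C1 maps *)

(** Joint continuity of the differential in the point and the direction, seen by
    expanding the direction on the standard basis: the coefficients are the
    partial derivatives, which are continuous. *)
Lemma Ck1_diff_cvg (R : realType) (m n : nat) (U : set 'rV[R]_m)
    (F : 'rV[R]_m -> 'rV[R]_n) (z w : 'rV[R]_m) :
  open U -> Ck 1 U F -> U z ->
  (fun p : 'rV[R]_m * 'rV[R]_m => 'd F (p.1) (p.2)) @ (z, w) --> 'd F z w.
Proof.
move=> oU [Fd Fc] Uz.
have dE x (u : 'rV[R]_m) : U x -> \sum_(j < m) u 0 j *: 'D_('e_j) F x = 'd F x u.
  move=> Ux; rewrite {2}[u]row_sum_delta linear_sum; apply: eq_bigr => j _.
  by rewrite deriveE ?linearZ//; exact: Fd.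
have L : (fun p : 'rV[R]_m * 'rV[R]_m => \sum_(j < m) p.2 0 j *: 'D_('e_j) F p.1)
    @ (z, w) --> \sum_(j < m) w 0 j *: 'D_('e_j) F z.
  apply: (@cvg_big _ _ +%R) => [|j _]; first exact: add_continuous.
  apply: cvgZ.
    apply: (@continuous_cvg _ _ _ _ _ snd (fun u : 'rV[R]_m => u 0 j)).
      exact: coord_continuous.
    exact: cvg_snd.
  apply: (@cvg_comp _ _ _ fst ('D_('e_j) F)); first exact: cvg_fst.
  exact: Fc Uz.
apply: cvg_trans (eq_ind _ (fun y => _ --> y) L _ (dE z w Uz)).
apply: near_eq_cvg.
near=> p; apply: dE; near: p; apply: cvg_fst.
exact: open_nbhs_nbhs.
Unshelve. all: by end_near. Qed.

(** The mean value theorem holds one coordinate at a time: the intermediate point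
    depends on the coordinate [k]. *)
Lemma mean_value_coord (R : realType) (m n : nat)
    (F : 'rV[R]_m -> 'rV[R]_n) (x v : 'rV[R]_m) (k : 'I_n) :
  (forall a : R, a \in `[0, 1] -> differentiable F (a *: v + x)) ->
  exists2 a : R, a \in `[0, 1] &
    (F (v + x) - F x) 0 k = 'd F (a *: v + x) v 0 k.
Proof.
move=> Fd; pose h (a : R) := F (a *: v + x).
have h_diff (a : R) : a \in `[0, 1] ->
    is_diff a h (fun b => 'd F (a *: v + x) (b *: v)).
  move=> /Fd Fa.
  have line : is_diff a (fun b : R => b *: v + x) (fun b : R => b *: v).
    by apply: is_diff_eq; rewrite addr0.
  have dF : is_diff (a *: v + x) F ('d F (a *: v + x)) by exact: DiffDef.
  exact: (@is_diff_comp _ _ _ _ (fun b : R => b *: v + x) _ F).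
pose g (a : R) : R := h a 0 k.
pose h' (a : R) : R := 'd F (a *: v + x) v 0 k.
have g_derive (a : R) : a \in `[0, 1] -> is_derive a 1 g (h' a).
  move=> /h_diff ha; have dha : differentiable h a by exact: ex_diff.
  have dka : derivable h a 1 by exact: diff_derivable.
  apply: DeriveDef; first exact: (derivable_mxP _ _ _).1.
  have := derive_mx dka; rewrite deriveE// diff_val scale1r => /matrixP/(_ 0 k).
  by rewrite mxE => <-.
have M := @MVT_segment R g h' 0 1 ler01.
have D (a : R) : a \in `]0, 1[ -> is_derive a 1 g (h' a).
  by move=> /subset_itv_oo_cc; exact: g_derive.
have C : {within `[0, 1], continuous g}.
  by apply: derivable_within_continuous => a a01; have [] := g_derive _ a01.
have [a a01] := M D C.
rewrite subr0 mulr1 /g /h scale1r scale0r add0r => E.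
by exists a => //; rewrite -[RHS]/(h' a) -E !mxE.
Qed.

(** By the mean value theorem each coordinate of the quotient is that of the
    differential at a point of the segment from [s k] to [t k], applied to
    [c k *: (t k - s k)]. This point tends to [z], so joint continuity of the
    differential gives the limit. *)
Lemma Ck1_diff_quotient_cvg (R : realType) (m n : nat) (U : set 'rV[R]_m)
    (F : 'rV[R]_m -> 'rV[R]_n) (z w : 'rV[R]_m) (s t : nat -> 'rV[R]_m)
    (c : nat -> R) :
  open U -> Ck 1 U F -> U z -> s @ \oo --> z -> t @ \oo --> z ->
  (fun k => c k *: (t k - s k)) @ \oo --> w ->
  (fun k => c k *: (F (t k) - F (s k))) @ \oo --> 'd F z w.
Proof.
move=> oU FC Uz sz tz cw.
(* [G] stands for the differential of [F], known through its homogeneity, the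
   mean value theorem and its joint continuity. *)
suff H (G : 'rV[R]_m -> 'rV[R]_m -> 'rV[R]_n) :
    (forall x b u, G x (b *: u) = b *: G x u) ->
    (forall x v k, (forall a : R, a \in `[0, 1] -> U (a *: v + x)) ->
      exists2 a : R, a \in `[0, 1] &
        (F (v + x) - F x) 0 k = G (a *: v + x) v 0 k) ->
    (fun p : 'rV[R]_m * 'rV[R]_m => G p.1 p.2) @ (z, w) --> G z w ->
    (fun k => c k *: (F (t k) - F (s k))) @ \oo --> G z w.
  apply: (H (fun x u => 'd F x u)) => [x b u|x v k seg|].
  - exact: linearZ.
  - by apply: mean_value_coord => a /seg; exact: FC.1.
  - exact: Ck1_diff_cvg oU FC Uz.
move=> GZ Gmvt Gc; apply/cvg_ballP => e e0.
have [[A B] /= [/nbhs_ballP[r r0 rA] Bw] AB] := (cvg_ballP _ _).1 Gc e e0.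
have [q q0 qU] : nbhs_ball z U by apply/nbhs_ballP; exact: open_nbhs_nbhs.
pose d := Num.min r q; have d0 : 0 < d by rewrite lt_min r0 q0.
have [dr dq] : d <= r /\ d <= q by rewrite !ge_min !lexx orbT.
near=> k.
have sk : ball z d (s k) by near: k; apply: sz; exact: nbhsx_ballx.
have tk : ball z d (t k) by near: k; apply: tz; exact: nbhsx_ballx.
have Bk : B (c k *: (t k - s k)) by near: k; exact: cw.
(* The ball is convex. *)
have seg (a : R) : a \in `[0, 1] -> ball z d (a *: (t k - s k) + s k).
  rewrite in_itv /= => /andP[a0 a1].
  move: sk tk; rewrite -ball_normE /= => sk tk.
  have -> : z - (a *: (t k - s k) + s k) =
      (1 - a) *: (z - s k) + a *: (z - t k).
    by rewrite !scalerBr !scalerBl !scale1r; apply/rowP => j; rewrite !mxE; ring.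
  apply: le_lt_trans (ler_normD _ _) _.
  rewrite !normrZ [`|1 - a|]ger0_norm ?subr_ge0// [`|a|]ger0_norm//.
  have [->|an0] := eqVneq a 0; first by rewrite mul0r addr0 subr0 mul1r.
  have ap : 0 < a by rewrite lt_def an0.
  have -> : d = (1 - a) * d + a * d by ring.
  apply: ler_ltD; first by rewrite ler_wpM2l ?subr_ge0// ltW.
  by rewrite ltr_pM2l.
split => // i j; rewrite ord1.
have [a a01] := Gmvt (s k) (t k - s k) j
  (fun a a01 => qU _ (le_ball dq (seg a a01))).
rewrite subrK => FE; rewrite [X in ball _ _ X]mxE FE.
have [] := AB (_, _) (conj (rA _ (le_ball dr (seg a a01))) Bk).
by move=> _ /(_ 0 j) /=; rewrite GZ mxE.
Unshelve. all: by end_near. Qed.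

(** * Tangent vectors and changes of charts *)

Lemma near_coord (R : realType) (M : smoothSpace R) (i : chart M) (p : M)
    (A : set M) :
  dom i p -> open A -> A p ->
  \forall z \near coord i p, exists q, [/\ dom i q, A q & z = coord i q].
Proof.
move=> ip oA Ap.
have pA : nbhs (coord i p) (param i @^-1` A).
  by apply: (param_cont ip); rewrite coordK//; exact: open_nbhs_nbhs.
have ci : nbhs (coord i p) (coord i @` dom i).
  by apply: open_nbhs_nbhs; split; [exact: image_open|exists p].
near=> z.
have [q iq qz] : (coord i @` dom i) z by near: z.
exists q; split => //; rewrite -(coordK iq) qz; near: z; exact: pA.
Unshelve. all: by end_near. Qed.

(** Chain rule for a change of charts. For [h] a coordinate map this is the
    cocycle relation between transitions; for [h] the composite of a map and a
    coordinate map it says that the differential of that map in charts does not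
    depend on the chart at the source. *)
Lemma diff_chart_change (R : realType) (M : smoothSpace R)
    (W : normedModType R) (h : M -> W) (p : M) (i j : chart M)
    (v : 'rV[R]_(dim i)) :
  dom i p -> dom j p -> differentiable (h \o param j) (coord j p) ->
  'd (h \o param i) (coord i p) v =
  'd (h \o param j) (coord j p) ('d (transition i j) (coord i p) v).
Proof.
move=> ip jp dh.
have dt : differentiable (transition i j) (coord i p).
  by apply: (transition_smooth i j 1).1; exists p.
have tE : transition i j (coord i p) = coord j p by rewrite /transition/= coordK.
have dh' : differentiable (h \o param j) (transition i j (coord i p)) by rewrite tE.
have near_eq : \forall z \near coord i p,
    ((h \o param j) \o transition i j) z = (h \o param i) z.
  have := near_coord ip (dom_open j) jp; apply: filterS => _ [q [iq jq ->]].
  by rewrite /transition /= !coordK.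
have [_ ->] := near_eq_diff near_eq (differentiable_comp dt dh').
have chain := congr1 (fun D => D v) (diff_comp dt dh').
exact: (eq_ind _ (fun z => _ = 'd (h \o param j) z _) chain _ tE).
Qed.

Lemma diff_transition_id (R : realType) (M : smoothSpace R) (p : M)
    (i : chart M) (v : 'rV[R]_(dim i)) :
  dom i p -> 'd (transition i i) (coord i p) v = v.
Proof.
move=> ip.
have near_eq : \forall z \near coord i p, id z = transition i i z.
  have := near_coord ip (dom_open i) ip; apply: filterS => _ [q [iq _ ->]].
  by rewrite /transition /= !coordK.
have [_ ->] := near_eq_diff near_eq ex_diff.
by rewrite diff_val.
Qed.

(** One coordinate vector determines a tangent vector: transport it by the
    differentials of the transitions; the cocycle relation gives coherence. *)
Lemma tangent_of_coord (R : realType) (M : smoothSpace R) (p : M)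
    (i : chart_at p) (v : 'rV[R]_(dim (sval i))) :
  exists u : tangent p, tcoord u i = v.
Proof.
pose vc (j : chart_at p) : 'rV[R]_(dim (sval j)) :=
  'd (transition (sval i) (sval j)) (coord (sval i) p) v.
have vcE j k :
    vc k = 'd (transition (sval j) (sval k)) (coord (sval j) p) (vc j).
  apply: diff_chart_change; [exact: (proj2_sig i)|exact: (proj2_sig j)|].
  apply: (transition_smooth (sval j) (sval k) 1).1.
  by exists p => //; split; [exact: (proj2_sig j)|exact: (proj2_sig k)].
by exists (Tangent vcE); apply: diff_transition_id; exact: (proj2_sig i).
Qed.

(** * Whitney cones of maps in charts *)

Lemma cvg_row_mxP (R : realType) (n1 n2 : nat) (a : nat -> 'rV[R]_n1)
    (b : nat -> 'rV[R]_n2) (u : 'rV[R]_n1) (v : 'rV[R]_n2) :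
  (fun k => row_mx (a k) (b k)) @ \oo --> row_mx u v <->
  a @ \oo --> u /\ b @ \oo --> v.
Proof.
split=> [ab|[au bv]].
  have aE : lsubmx \o (fun k => row_mx (a k) (b k)) = a.
    by apply/funext => k /=; rewrite row_mxKl.
  have bE : rsubmx \o (fun k => row_mx (a k) (b k)) = b.
    by apply/funext => k /=; rewrite row_mxKr.
  split.
    rewrite -aE -[u](row_mxKl _ v).
    by apply: continuous_cvg ab; exact: continuous_lsubmx.
  rewrite -bE -[v](row_mxKr u).
  by apply: continuous_cvg ab; exact: continuous_rsubmx.
apply: (@cvg_comp _ _ _ (fun k => (a k, b k))
  (fun p : 'rV[R]_n1 * 'rV[R]_n2 => row_mx p.1 p.2) _ _ _ (cvg_pair au bv)).
exact: (@continuous_row_mx R n1 n2 (u, v)).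
Qed.

(** The point [q = f p] is forced: the second components of the sequences are the
    images by [f] of the first ones, hence tend both to [q] and to [f p]. *)
Lemma map_coneP (R : realType) (M N : manifold R) (f : M -> N)
    (p : M) (q : N) (u : tangent p) (v : tangent q) :
  continuous f ->
  map_cone f (existT _ p u, existT _ q v) <->
  q = f p /\ exists (i : chart_at p) (j : chart_at q) (x y : nat -> M)
    (c : nat -> R),
    [/\ forall n, 0 < c n, x @ \oo --> p, y @ \oo --> p,
      (fun n => c n *: (coord (sval i) (y n) - coord (sval i) (x n))) @ \oo
        --> tcoord u i &
      (fun n => c n *: (coord (sval j) (f (y n)) - coord (sval j) (f (x n))))
        @ \oo --> tcoord v j].
Proof.
move=> fc; split.
  move=> [k [x [y [c [xyc xp yp cw]]]]].
  have x2E : snd \o x = (fun n => f (x n).1).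
    by apply/funext => n; have [] := xyc n.
  have y2E : snd \o y = (fun n => f (y n).1).
    by apply/funext => n; have [] := xyc n.
  have x1p : fst \o x @ \oo --> p by apply: cvg_comp xp _; exact: cvg_fst.
  have y1p : fst \o y @ \oo --> p by apply: cvg_comp yp _; exact: cvg_fst.
  split.
    apply: (cvg_unique (@manifold_hausdorff _ N) (F := snd \o x @ \oo)).
      by apply: cvg_comp xp _; exact: cvg_snd.
    by rewrite x2E; exact: continuous_cvg (fc p) x1p.
  exists (chart_fst k), (chart_snd k), (fst \o x), (fst \o y), c.
  have /cvg_row_mxP[cu cv] : (fun n => row_mx
      (c n *: (coord (sval k).1 (y n).1 - coord (sval k).1 (x n).1))
      (c n *: (coord (sval k).2 (y n).2 - coord (sval k).2 (x n).2))) @ \oo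
     --> row_mx (tcoord u (chart_fst k)) (tcoord v (chart_snd k)).
    apply: cvg_trans cw; apply: near_eq_cvg; apply: nearW => n.
    by rewrite -scale_row_mx -add_row_mx -opp_row_mx.
  split => //; first by move=> n; have [] := xyc n.
  apply: cvg_trans cv; apply: near_eq_cvg; apply: nearW => n /=.
  by rewrite -[f (x n).1](congr1 (@^~ n) x2E) -[f (y n).1](congr1 (@^~ n) y2E).
move=> [qE [[i ip] [[j jq] [x [y [c [c0 xp yp cu cv]]]]]]].
exists (pair_chart (exist _ i ip) (exist _ j jq)),
  (fun n => (x n, f (x n))), (fun n => (y n, f (y n))), c.
split => //=.
- have fxp : f \o x @ \oo --> q by rewrite qE; exact: continuous_cvg (fc p) xp.
  exact: cvg_pair xp fxp.
- have fyp : f \o y @ \oo --> q by rewrite qE; exact: continuous_cvg (fc p) yp.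
  exact: cvg_pair yp fyp.
have ab := (cvg_row_mxP _ _ _ _).2 (conj cu cv).
apply: cvg_trans ab.
apply: near_eq_cvg; apply: nearW => n /=.
by rewrite -scale_row_mx -add_row_mx -opp_row_mx.
Qed.

(** * The inclusion for C1 maps *)

Lemma C1_map_push (R : realType) (M N : manifold R) (f : M -> N) (p : M)
    (i : chart_at p) (j : chart_at (f p)) (x y : nat -> M) (c : nat -> R)
    (w : 'rV[R]_(dim (sval i))) :
  C1_map f -> x @ \oo --> p -> y @ \oo --> p ->
  (fun n => c n *: (coord (sval i) (y n) - coord (sval i) (x n))) @ \oo --> w ->
  (fun n => c n *: (coord (sval j) (f (y n)) - coord (sval j) (f (x n)))) @ \oo
    --> 'd ((coord (sval j) \o f) \o param (sval i)) (coord (sval i) p) w.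
Proof.
case: i w => [i ip] /= w; case: j => [j jfp] /= [fc fC1] xp yp cw.
have ofj : open (f @^-1` dom j).
  by apply: open_comp => [q _|]; [exact: fc|exact: dom_open].
have Uo : open (coord i @` (dom i `&` f @^-1` dom j)).
  rewrite openE => _ [q [iq jfq] <-].
  have := near_coord iq ofj jfq; apply: filterS => _ [q' [iq' jq' ->]].
  by exists q'.
have Up : (coord i @` (dom i `&` f @^-1` dom j)) (coord i p) by exists p.
have sx : coord i \o x @ \oo --> coord i p.
  exact: continuous_cvg (coord_cont ip) xp.
have sy : coord i \o y @ \oo --> coord i p.
  exact: continuous_cvg (coord_cont ip) yp.
have L := Ck1_diff_quotient_cvg Uo (fC1 i j) Up sx sy cw.
apply: cvg_trans L; apply: near_eq_cvg.
have nbhs_dom : nbhs p (dom i) by apply: open_nbhs_nbhs; split; [exact: dom_open|].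
have xd : \forall n \near \oo, dom i (x n) by exact: xp.
have yd : \forall n \near \oo, dom i (y n) by exact: yp.
by apply: filterS2 xd yd => n xn yn /=; rewrite !coordK.
Qed.

(** The cone of a [C1] map is contained in the graph of its tangent map. The
    target chart is the one given by the cone, but the source chart is arbitrary,
    so that it can be matched with a chart coming from another cone. *)
Lemma map_cone_diff (R : realType) (M N : manifold R) (f : M -> N) (p : M)
    (u : tangent p) (v : tangent (f p)) :
  C1_map f -> map_cone f (existT _ p u, existT _ (f p) v) ->
  exists j : chart_at (f p), forall i : chart_at p,
    tcoord v j =
    'd ((coord (sval j) \o f) \o param (sval i)) (coord (sval i) p) (tcoord u i).
Proof.
move=> fC1 /(map_coneP _ _ fC1.1)[_ [i [j [x [y [c [_ xp yp cu cv]]]]]]].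
exists j => i'; have uE := tcoordE u i' i.
have hj := C1_map_push (j := j) fC1 xp yp cu.
have -> := cvg_unique (@norm_hausdorff _ _) cv hj.
rewrite uE; apply: esym; apply: diff_chart_change.
- exact: (proj2_sig i').
- exact: (proj2_sig i).
apply: (fC1.2 (sval i) (sval j)).1; exists p => //; split.
  exact: (proj2_sig i).
exact: (proj2_sig j).
Qed.

Lemma map_cone_comp_C1 (R : realType) (M1 M2 M3 : manifold R)
    (f1 : M1 -> M2) (f2 : M2 -> M3) :
  continuous f1 -> C1_map f2 ->
  rel_comp (map_cone f1) (map_cone f2) `<=` map_cone (f2 \o f1).
Proof.
move=> f1c f2C1 [[p1 u1] [p3 u3]] [[p2 u2] [/= C1 C2]].
have f2c := f2C1.1.
have [p2E _] := (map_coneP u1 u2 f1c).1 C1.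
have [p3E _] := (map_coneP u2 u3 f2c).1 C2.
subst p2; subst p3.
have [j u3E] := map_cone_diff f2C1 C2.
have [_ [i [l [x [y [c [c0 xp yp cu1 cu2]]]]]]] := (map_coneP u1 u2 f1c).1 C1.
apply/map_coneP; first by move=> z; apply: continuous_comp; [exact: f1c|exact: f2c].
split => //; exists i, j, x, y, c; split => //.
rewrite (u3E l); apply: C1_map_push => //.
- exact: continuous_cvg (f1c p1) xp.
- exact: continuous_cvg (f1c p1) yp.
Qed.

(** * The inclusion for Whitney-regular pairs *)

(** Projective compactness: [d] has a subsequence that converges, after positive
    rescaling by [rho], in such a way that the limits of the factors and of the
    rescaled vectors are not both 0. For [t > 0] the subsequence of [d] itself
    converges, for [t = 0] its directions do. *)
Lemma rescaled_subseq (R : realType) (n : nat) (d : nat -> 'rV[R]_n) :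
  exists (phi : nat -> nat) (rho : nat -> R) (t : R) (v : 'rV[R]_n),
  [/\ phi @ \oo --> \oo, forall k, 0 < rho k,
      rho \o phi @ \oo --> t,
      (fun k => rho (phi k) *: d (phi k)) @ \oo --> v &
      0 <= t /\ (t = 0 -> v != 0)].
Proof.
pose s k := Num.max 1 `|d k|; pose rho k := (s k)^-1.
have s1 k : 1 <= s k by rewrite le_max lexx.
have s0 k : 0 < s k by exact: lt_le_trans (s1 k).
have rho0 k : 0 < rho k by rewrite invr_gt0.
have rho1 k : rho k <= 1 by rewrite invf_le1.
pose e k : 'rV[R]_(1 + n) := row_mx (const_mx (rho k)) (rho k *: d k).
have e1 k : `|e k| <= 1.
  rewrite [leLHS]/Num.Def.normr/= mx_normrE bigmax_le// => -[a b] _ /=.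
  rewrite mxE; case: (fintype.split b) => b'; rewrite mxE.
    by rewrite ger0_norm// ltW.
  rewrite normrM ger0_norm ?(ltW (rho0 k))// mulrC ler_pdivrMr// mul1r.
  apply: le_trans (_ : `|d k| <= _); last by rewrite le_max lexx orbT.
  by rewrite [leRHS]/Num.Def.normr/= mx_normrE; exact: (le_bigmax _ _ (a, b')).
have [v' [phi phioo ev]] := bounded_rV_subseq e1.
pose t : R := lsubmx v' 0 0; pose v := rsubmx v'.
have rt : rho \o phi @ \oo --> t.
  have -> : rho \o phi = (fun x => lsubmx x 0 0) \o (e \o phi).
    by apply/funext => k /=; rewrite row_mxKl mxE.
  apply: continuous_cvg ev.
  apply: (@continuous_comp _ _ _ lsubmx (fun x : 'rV[R]_1 => x 0 0)).
    exact: continuous_lsubmx.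
  exact: coord_continuous.
have dv : (fun k => rho (phi k) *: d (phi k)) @ \oo --> v.
  have -> : (fun k => rho (phi k) *: d (phi k)) = rsubmx \o (e \o phi).
    by apply/funext => k /=; rewrite row_mxKr.
  by apply: continuous_cvg ev; exact: continuous_rsubmx.
exists phi, rho, t, v; split => //; split.
  rewrite -(cvg_lim (@Rhausdorff _) rt); apply: limr_ge; first by apply/cvg_ex; exists t.
  by apply: nearW => k /=; rewrite ltW.
move=> t0; rewrite -normr_gt0.
(* Once [rho] is less than 1, the maximum in [s] is the norm of [d], so the
   rescaled vectors are unit vectors. *)
suff -> : `|v| = 1 by [].
apply: (cvg_unique (@Rhausdorff R) (cvg_norm dv)).
have : \forall k \near \oo, 1 = `|rho (phi k) *: d (phi k)|.
  have /cvgrPdist_lt/(_ 1 ltr01) := rt; rewrite t0.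
  apply: filterS => k /=; rewrite sub0r normrN ger0_norm ?(ltW (rho0 _))// => r1.
  rewrite normrZ ger0_norm ?(ltW (rho0 _))//.
  have -> : `|d (phi k)| = s (phi k); last by rewrite mulVf// gt_eqF.
  rewrite /s; case: leP => // d1.
  by move: r1; rewrite /rho /s (max_l (ltW d1)) invr1 ltxx.
by move=> /near_eq_cvg/cvg_trans; apply; exact: cvg_cst.
Qed.

Lemma zero_section_coord (R : realType) (M : smoothSpace R) (p : M)
    (u : tangent p) (i : chart_at p) :
  tcoord u i = 0 -> zero_section M (existT _ p u).
Proof. by move=> u0 j /=; rewrite (tcoordE u i j) u0; exact: linear0. Qed.

Lemma map_cone_comp_regular (R : realType) (M1 M2 M3 : manifold R)
    (f1 : M1 -> M2) (f2 : M2 -> M3) :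
  continuous f1 -> continuous f2 -> whitney_regular f1 f2 ->
  map_cone (f2 \o f1) `<=` rel_comp (map_cone f1) (map_cone f2).
Proof.
move=> f1c f2c reg [[p1 u1] [p3 u3]] C.
have f21c : continuous (f2 \o f1).
  by move=> z; apply: continuous_comp; [exact: f1c|exact: f2c].
have [p3E [i [j [x [y [c [c0 xp yp cu1 cu3]]]]]]] := (map_coneP u1 u3 f21c).1 C.
simpl in p3E; subst p3; rewrite /= in cu3.
have [l0 lp] := dom_cover (f1 p1); pose l : chart_at (f1 p1) := exist _ l0 lp.
pose d n := c n *: (coord (sval l) (f1 (y n)) - coord (sval l) (f1 (x n))).
have [phi [rho [t [v [phioo rho0 rt dv [t0 tv]]]]]] := rescaled_subseq d.
(* Multiplied by [rho] and a fixed [a > 0], all three sequences of difference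
   quotients still converge along [phi]. *)
have rescaled (a : R) (w1 : tangent p1) (w2 : tangent (f1 p1))
    (w3 : tangent (f2 (f1 p1))) : 0 < a ->
    tcoord w1 i = a *: (t *: tcoord u1 i) -> tcoord w2 l = a *: v ->
    tcoord w3 j = a *: (t *: tcoord u3 j) ->
    map_cone f1 (existT _ p1 w1, existT _ (f1 p1) w2) /\
    map_cone f2 (existT _ (f1 p1) w2, existT _ (f2 (f1 p1)) w3).
  move=> a0 w1E w2E w3E.
  pose c' n := a * (rho (phi n) * c (phi n)).
  have c'0 n : 0 < c' n by rewrite !mulr_gt0.
  have x'p : x \o phi @ \oo --> p1 by exact: cvg_comp phioo xp.
  have y'p : y \o phi @ \oo --> p1 by exact: cvg_comp phioo yp.
  have scale m (e : nat -> 'rV[R]_m) (w : 'rV[R]_m) :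
      (fun n => rho (phi n) *: (c (phi n) *: e n)) @ \oo --> w ->
      (fun n => c' n *: e n) @ \oo --> a *: w.
    move=> ew.
    have aew : (fun n => a *: (rho (phi n) *: (c (phi n) *: e n))) @ \oo --> a *: w.
      by apply: cvgZ ew; exact: cvg_cst.
    apply: cvg_trans aew; apply: near_eq_cvg; apply: nearW => n.
    by rewrite /c' !scalerA mulrA.
  have cw1 : (fun n => c' n *: (coord (sval i) (y (phi n)) -
      coord (sval i) (x (phi n)))) @ \oo --> tcoord w1 i.
    by rewrite w1E; apply: scale; exact: cvgZ rt (cvg_comp _ _ phioo cu1).
  have cw2 : (fun n => c' n *: (coord (sval l) (f1 (y (phi n))) -
      coord (sval l) (f1 (x (phi n))))) @ \oo --> tcoord w2 l.
    by rewrite w2E; exact: scale dv.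
  have cw3 : (fun n => c' n *: (coord (sval j) (f2 (f1 (y (phi n)))) -
      coord (sval j) (f2 (f1 (x (phi n)))))) @ \oo --> tcoord w3 j.
    by rewrite w3E; apply: scale; exact: cvgZ rt (cvg_comp _ _ phioo cu3).
  split.
    apply/map_coneP => //; split => //.
    by exists i, l, (x \o phi), (y \o phi), c'.
  apply/map_coneP => //; split => //.
  exists l, j, (f1 \o x \o phi), (f1 \o y \o phi), c'; split => //.
  - exact: continuous_cvg (f1c p1) x'p.
  - exact: continuous_cvg (f1c p1) y'p.
(* For [t = 0], [v] contradicts regularity; for [t > 0], the factor [t^-1]
   restores [u1] and [u3]. *)
have [tz|tnz] := eqVneq t 0.
  have [w1 w1E] := tangent_of_coord (i := i) 0.
  have [w2 w2E] := tangent_of_coord (i := l) v.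
  have [w3 w3E] := tangent_of_coord (i := j) 0.
  have [||||C1 C2] := rescaled 1 w1 w2 w3.
  - exact: ltr01.
  - by rewrite w1E tz scale0r scaler0.
  - by rewrite w2E scale1r.
  - by rewrite w3E tz scale0r scaler0.
  have [_ /(_ l) w20 _] := reg _ _ _ (conj C1 (zero_section_coord w3E))
    (conj (zero_section_coord w1E) C2).
  by move: (tv tz); rewrite -w2E w20 eqxx.
have tp : 0 < t by rewrite lt_def tnz.
have [w2 w2E] := tangent_of_coord (i := l) (t^-1 *: v).
exists (existT _ (f1 p1) w2); apply: (rescaled t^-1) => //.
- by rewrite invr_gt0.
- by rewrite scalerA mulVf// scale1r.
- by rewrite scalerA mulVf// scale1r.
Qed.

Theorem proposition3p13 (R : realType) (M1 M2 M3 : manifold R)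
    (f1 : M1 -> M2) (f2 : M2 -> M3)
    (f1_cont : continuous f1) (f2_cont : continuous f2) :
  (whitney_regular f1 f2 ->
     map_cone (f2 \o f1) `<=` rel_comp (map_cone f1) (map_cone f2)) /\
  (C1_map f2 ->
     rel_comp (map_cone f1) (map_cone f2) `<=` map_cone (f2 \o f1)).
Proof.
by split; [exact: map_cone_comp_regular|exact: map_cone_comp_C1].
Qed.
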